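(* There is an absolute constant $C>0$ such that, for every integer $s\ge 0$ and every finite set $U$, if $\mathcal F\subseteq 2^U\setminus\{\varnothing\}$ is nonempty and $|A\cap B|\le s$ for all distinct $A,B\in\mathcal F$, then $p_c(\mathcal F)\le C\,q(\mathcal F)\log(s+2)$.
   Context: $\log$ is the natural logarithm. $W\sim\mathrm{Bin}(U,p)$ means that each point of the finite set $U$ is included in the random set $W$ independently with probability $p$. Let $\mathcal F\subseteq 2^U\setminus\{\varnothing\}$ be nonempty. The threshold $p_c(\mathcal F)$ is the unique $p\in[0,1]$ such that $\Pr_W[\exists S\in\mathcal F:S\subseteq W]=1/2$ for $W\sim\mathrm{Bin}(U,p)$. A family $\mathcal G\subseteq 2^U$ covers $\mathcal F$ if every $S\in\mathcal F$ contains some $T\in\mathcal G$ as a subset. The expectation threshold $q(\mathcal F)$ is the largest $p\in[0,1]$ for which some family $\mathcal G\subseteq2^U$ covering $\mathcal F$ satisfies $\sum_{T\in\mathcal G}p^{|T|}\le \frac12$ (with $p^{0}=1$). *)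

(* Defs.v *)
From mathcomp Require Import all_boot all_order all_algebra.
From mathcomp Require Import all_classical all_reals all_analysis.

Set Implicit Arguments.
Unset Strict Implicit.
Unset Printing Implicit Defensive.

Import Order.TTheory GRing.Theory Num.Theory.
Local Open Scope ring_scope.

(* Probability of the event [E] under Bin(U, p): independence makes the mass of
   an outcome [W] a product over the points of [U]. *)
Definition binPr (R : realType) (U : finType) (p : R) (E : pred {set U}) : R :=
  \sum_(W : {set U} | E W) \prod_(x : U) (if x \in W then p else 1 - p).

Definition contains_member (U : finType) (F : {set {set U}}) : pred {set U} :=
  fun W => [exists S in F, S \subset W].

(* When F is nonempty and does not contain the empty set, the probability is a
   polynomial in p that increases strictly from 0 to 1 on [0, 1]; the set below
   is then a singleton, and the default value 0 is irrelevant. *)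
Definition threshold (R : realType) (U : finType) (F : {set {set U}}) : R :=
  xget 0 [set p : R | 0 <= p <= 1 /\
                      binPr p (contains_member F) = 1 / 2]%classic.

Definition covers (U : finType) (G F : {set {set U}}) : Prop :=
  forall S, S \in F -> exists2 T, T \in G & T \subset S.

(* Note that p ^+ 0 = 1, also for p = 0. *)
Definition small_cover_set (R : realType) (U : finType) (F : {set {set U}}) :
    set R :=
  [set p : R | 0 <= p <= 1 /\
     exists2 G : {set {set U}}, covers G F &
       \sum_(T in G) p ^+ #|T| <= 1 / 2]%classic.

(* [A `&` ubound A] consists of the largest element of [A], if there is one.
   When the empty set is not in F, [small_cover_set F] contains 0 (take G := F)
   and is compact, so it has a largest element and the default value 0 is
   irrelevant. *)
Definition expectation_threshold (R : realType) (U : finType)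
    (F : {set {set U}}) : R :=
  let A : set R := small_cover_set F in xget 0 (A `&` ubound A)%classic.

(* Main.v *)
(** Work with a random set [W] of density [P = 32 p], where every cover of [F]
    costs at least [1/2] at [p].

    First round.  Call [S] in [F] lonely if it is the only edge inside
    [W :|: S].  Given [Z = W :|: S] there is at most one such [S], and planting
    [S] costs a factor [P ^ #|S|], so the lonely edges have expected cost at most
    [p / P = 1/32].  If [S] is not lonely, another edge [S'] leaves a fragment
    [S' :\: W] inside [S :&: S'], which has at most [s] points.

    Later rounds (Park and Pham).  Sets with fewer than [2 ^ k.+1] points
    are replaced by their minimum fragments; those with at least [2 ^ k] points have
    small expected cost, because [Z = W :|: T] determines an edge containing [T].
    About [log s] rounds reduce everything to the empty fragment.

    The induction carries the bound: the probability of missing [H] is at most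
    one minus the minimum cost of a cover of [H], plus an error.  Being linear in
    the cost, it passes through the expectation over the previous rounds.  The total error is below [1/5], and a
    second independent copy brings the failure probability below
    [(7/10)^2 < 1/2]. *)
Require Import Defs.
From mathcomp Require Import all_boot all_order all_algebra.
From mathcomp Require Import all_classical all_reals all_analysis.
From mathcomp Require Import ring lra.

Set Implicit Arguments.
Unset Strict Implicit.
Unset Printing Implicit Defensive.

Import Order.TTheory GRing.Theory Num.Theory.
Import numFieldNormedType.Exports.
Local Open Scope ring_scope.

(** * Product measures on subsets of [U] *)

(** The density may vary from point to point, so that a deterministic set (densities 0 and 1) is a
    special case. *)
Definition bernoulli_mass (R : realType) (U : finType) (r : U -> R)
    (W : {set U}) : R :=
  \prod_(x : U) (if x \in W then r x else 1 - r x).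

Definition expect (R : realType) (U : finType) (r : U -> R)
    (g : {set U} -> R) : R :=
  \sum_(W : {set U}) bernoulli_mass r W * g W.

Lemma sum_bernoulli_mass (R : realType) (U : finType) (r : U -> R) :
  \sum_(W : {set U}) bernoulli_mass r W = 1.
Proof.
rewrite /bernoulli_mass -(bigA_distr _ _ r (fun x => 1 - r x)).
by rewrite big1 // => x _ /=; rewrite addrCA subrr addr0.
Qed.

Lemma expect_cst (R : realType) (U : finType) (r : U -> R) (c : R) :
  expect r (fun=> c) = c.
Proof. by rewrite /expect -mulr_suml sum_bernoulli_mass mul1r. Qed.

Lemma bernoulli_mass_ge0 (R : realType) (U : finType) (r : U -> R) W :
  (forall x, 0 <= r x <= 1) -> 0 <= bernoulli_mass r W.
Proof.
move=> r01; apply: prodr_ge0 => x _.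
by have /andP[? ?] := r01 x; case: ifP; rewrite ?subr_ge0.
Qed.

Lemma le_expect (R : realType) (U : finType) (r : U -> R) g h :
  (forall x, 0 <= r x <= 1) -> (forall W, g W <= h W) ->
  expect r g <= expect r h.
Proof.
by move=> r01 gh; apply: ler_sum => W _; rewrite ler_wpM2l ?bernoulli_mass_ge0.
Qed.

Lemma expectD (R : realType) (U : finType) (r : U -> R) g h :
  expect r (fun W => g W + h W) = expect r g + expect r h.
Proof. by rewrite /expect -big_split; apply: eq_bigr => W _; rewrite mulrDr. Qed.

Lemma expectZ (R : realType) (U : finType) (r : U -> R) c g :
  expect r (fun W => c * g W) = c * expect r g.
Proof. by rewrite /expect big_distrr; apply: eq_bigr => W _; rewrite mulrCA. Qed.

Lemma expect_sum (R : realType) (U I : finType) (r : U -> R) (P : pred I)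
    (g : I -> {set U} -> R) :
  expect r (fun W => \sum_(i | P i) g i W) = \sum_(i | P i) expect r (g i).
Proof.
rewrite /expect exchange_big; apply: eq_bigr => W _.
by rewrite big_distrr.
Qed.

(** Independently for each [x], the union avoids [x] exactly when both sets do. This is what splits
    one random set into rounds. *)
Lemma expect_setU (R : realType) (U : finType) (r r' : U -> R)
    (g : {set U} -> R) :
  expect r (fun W => expect r' (fun W' => g (W :|: W'))) =
  expect (fun x => 1 - (1 - r x) * (1 - r' x)) g.
Proof.
pose m x (b : bool * bool) :=
  (if b.1 then r x else 1 - r x) * (if b.2 then r' x else 1 - r' x).
pose un (f : {ffun U -> bool * bool}) := [set x | (f x).1 || (f x).2].
transitivity (\sum_(f : {ffun U -> bool * bool})
    (\prod_x m x (f x)) * g (un f)).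
  rewrite /expect.
  under eq_bigr do rewrite big_distrr.
  rewrite pair_bigA /=.
  rewrite (reindex (fun f : {ffun U -> bool * bool} =>
    ([set x | (f x).1], [set x | (f x).2]))) /=; last first.
    exists (fun p : {set U} * {set U} => [ffun x => (x \in p.1, x \in p.2)]).
      by move=> f _; apply/ffunP => x; rewrite ffunE /= !inE; case: (f x).
    move=> [A B] _ /=; congr (_, _); apply/finset.setP => x;
    by rewrite inE ffunE.
  apply: eq_bigr => f _; rewrite mulrA; congr (_ * g _); last first.
    by apply/finset.setP => x; rewrite !inE.
  rewrite /bernoulli_mass -big_split; apply: eq_bigr => x _ /=.
  by rewrite !inE.
(* Group the pairs by their union [Z]. The condition that the union is [Z] is pointwise, so the mass
   of each group factors over the points. *)
rewrite (partition_big un xpredT) //=; apply: eq_bigr => Z _.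
rewrite (eq_bigr (fun f : {ffun U -> bool * bool} =>
    (\prod_x m x (f x)) * g Z)); last by move=> f /eqP ->.
rewrite -big_distrl; congr (_ * _).
pose Q x := [pred b : bool * bool | (b.1 || b.2) == (x \in Z)].
transitivity (\sum_(f in family Q) \prod_x m x (f x)).
  apply: eq_bigl => f; apply/eqP/familyP => [fZ x|fQ].
    by rewrite !inE -fZ !inE.
  apply/finset.setP => x; have := fQ x; rewrite !inE => /eqP; exact.
rewrite -(bigA_distr_big_dep _ (fun x b => m x b)); apply: eq_bigr => x _.
rewrite big_mkcond.
rewrite -(pair_bigA _ (fun a b => if (a, b) \in Q x then m x (a, b) else 0)) /=.
rewrite !big_bool /= !inE /= /m /=.
by case: (x \in Z) => /=; ring.
Qed.

(* [W :|: S] is [W] joined with a random set of density 1 on [S] and 0 off [S],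
   so its law is that of [Z] conditioned on [S \subset Z]. *)
Lemma expect_plant (R : realType) (U : finType) (P : R) (S : {set U}) g :
  P ^+ #|S| * expect (fun=> P) (fun W => g (W :|: S)) =
  expect (fun=> P) (fun Z => (S \subset Z)%:R * g Z).
Proof.
pose r' x : R := (x \in S)%:R.
have massS W' : bernoulli_mass r' W' = (W' == S)%:R.
  rewrite /bernoulli_mass; have [->|/eqP neq] := eqVneq W' S.
    by apply: big1 => x _; rewrite /r'; case: (x \in S); rewrite ?subr0.
  have [x xW'S] : exists x, (x \in W') != (x \in S).
    apply/existsP; apply: contra_notT neq; rewrite negb_exists => /forallP e.
    by apply/finset.setP => x; have := e x; rewrite negbK => /eqP.
  rewrite (bigD1 x) //= /r'; move: xW'S.
  by case: (x \in W'); case: (x \in S); rewrite //= ?subrr mul0r.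
have -> : expect (fun=> P) (fun W => g (W :|: S)) =
    expect (fun=> P) (fun W => expect r' (fun W' => g (W :|: W'))).
  apply: eq_bigr => W _; congr (_ * _).
  rewrite /expect (bigD1 S) //= massS eqxx mul1r big1 ?addr0 // => W' W'S.
  by rewrite massS (negbTE W'S) mul0r.
rewrite expect_setU /expect big_distrr; apply: eq_bigr => Z _ /=.
rewrite !mulrA; congr (_ * _).
rewrite /bernoulli_mass -prodr_const big_mkcond -big_split /=.
case: (boolP (S \subset Z)) => [/fintype.subsetP SZ|/fintype.subsetPn[x xS xZ]].
  rewrite mulr1; apply: eq_bigr => x _; rewrite /r'.
  have := SZ x; case: (x \in S) => [/(_ isT) ->|_] /=.
    by rewrite subrr mulr0 subr0 mulr1.
  by rewrite subr0 mulr1 mul1r; case: ifP => //; rewrite opprB addrC subrK.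
rewrite mulr0 (bigD1 x) //= xS (negbTE xZ) /r' xS /= subrr mulr0 subr0 subrr.
by rewrite mulr0 mul0r.
Qed.

(** * Cover costs and a single round *)

Definition cost (R : realType) (U : finType) (p : R) (G : {set {set U}}) : R :=
  \sum_(T in G) p ^+ #|T|.

Definition miss (R : realType) (U : finType) (P : R) (H : {set {set U}}) : R :=
  expect (fun=> P) (fun W => (~~ contains_member H W)%:R).

Lemma cost_setU (R : realType) (U : finType) (p : R) (A B : {set {set U}}) :
  0 <= p -> cost p (A :|: B) <= cost p A + cost p B.
Proof.
move=> p0; rewrite /cost ![\sum_(_ in _) _]big_mkcond -big_split /=.
apply: ler_sum => T _; rewrite inE.
by case: (T \in A); case: (T \in B); rewrite /= ?addr0 ?add0r // lerDl exprn_ge0.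
Qed.

(** [G W] is the part of a cover paid for in this round and [H' W] is what remains to be hit. A
    cover of [H' W] completes [G W] to a cover of [H], so it costs at least [c - cost p (G W)];
    averaging over [W] loses at most [delta]. *)
Lemma miss_round (R : realType) (U : finType) (p P Q c eps delta : R)
    (H : {set {set U}}) (G H' : {set U} -> {set {set U}}) :
  0 <= p -> 0 <= P <= 1 -> 0 <= Q <= 1 ->
  (forall W G', covers G' (H' W) -> covers (G W :|: G') H) ->
  (forall W W', contains_member (H' W) W' -> contains_member H (W :|: W')) ->
  (forall W c', (forall G', covers G' (H' W) -> c' <= cost p G') ->
    miss Q (H' W) <= 1 - c' + eps) ->
  expect (fun=> P) (fun W => cost p (G W)) <= delta ->
  (forall G', covers G' H -> c <= cost p G') ->
  miss (1 - (1 - P) * (1 - Q)) H <= 1 - c + (eps + delta).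
Proof.
move=> p0 P01 Q01 covG memH missQ costG boundH.
rewrite /miss -(expect_setU (fun=> P) (fun=> Q)).
apply: (@le_trans _ _ (expect (fun=> P) (fun W => (1 - c + eps) + cost p (G W)))).
  apply: le_expect => // W.
  apply: (@le_trans _ _ (miss Q (H' W))).
    apply: le_expect => // W'; rewrite ler_nat.
    have := memH W W'; case: (contains_member (H' W) W') => [/(_ isT) -> //|_].
    exact: leq_b1.
  have -> : 1 - c + eps + cost p (G W) = 1 - (c - cost p (G W)) + eps by ring.
  apply: missQ => G' covG'; rewrite lerBlDl.
  by apply: le_trans (cost_setU _ _ p0); apply: boundH; apply: covG.
by rewrite expectD expect_cst addrA lerD2l.
Qed.

Lemma le_expect_cost (R : realType) (U : finType) (lam P : R)
    (G : {set U} -> {set {set U}}) (h : {set U} -> pred {set U}) :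
  0 <= lam -> 0 <= P <= 1 ->
  (forall W T, T \in G W -> h (W :|: T) T) ->
  expect (fun=> P) (fun W => cost (lam * P) (G W)) <=
  expect (fun=> P) (fun Z : {set U} =>
    \sum_(T : {set U} | (T \subset Z) && h Z T) lam ^+ #|T|).
Proof.
(* [(lam * P) ^ #|T|] times the probability of [T \in G W] is at most
   [lam ^ #|T|] times the planted expectation of [h _ T]. *)
move=> lam0 P01 Gh.
have -> : (fun W => cost (lam * P) (G W)) =
   (fun W => \sum_(T : {set U}) (lam * P) ^+ #|T| * (T \in G W)%:R).
  apply/funext => W; rewrite /cost big_mkcond; apply: eq_bigr => T _.
  by case: ifP; rewrite ?mulr1 ?mulr0.
have -> : (fun Z : {set U} =>
     \sum_(T : {set U} | (T \subset Z) && h Z T) lam ^+ #|T|) =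
   (fun Z : {set U} =>
     \sum_(T : {set U}) lam ^+ #|T| * ((T \subset Z)%:R * (h Z T)%:R)).
  apply/funext => W; rewrite /cost big_mkcond; apply: eq_bigr => T _.
  by rewrite -natrM mulnb; case: ifP; rewrite ?mulr1 ?mulr0.
rewrite !expect_sum; apply: ler_sum => T _; rewrite !expectZ exprMn -mulrA.
rewrite ler_wpM2l ?exprn_ge0 // -(expect_plant _ _ (fun Z => (h Z T)%:R)).
have /andP[P0 _] := P01.
rewrite ler_wpM2l ?exprn_ge0 //; apply: le_expect => // W.
by rewrite ler_nat; have := Gh W T; case: (T \in G W) => // /(_ isT) ->.
Qed.

(** * Minimum fragments and the later rounds *)

(* The last condition makes [T] minimum among the fragments of the edges inside
   [W :|: T], so that every such edge contains [T]. *)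
Definition fragments (U : finType) (H : {set {set U}}) (W : {set U}) :
    {set {set U}} :=
  [set T | [exists S in H, T == S :\: W] &&
           [forall S in H, (S \subset W :|: T) ==> (#|T| <= #|S :\: W|)%N]].

Lemma fragment_subset (U : finType) (H : {set {set U}}) (W S : {set U}) :
  S \in H -> exists2 T, T \in fragments H W & T \subset S.
Proof.
(* Among the edges inside [W :|: S], take one with the fewest points outside [W]. Its fragment lies
   in [S], and it remains minimum in the smaller set [W :|: T]. *)
move=> SH; pose P S' := (S' \in H) && (S' \subset W :|: S).
have PS : P S by rewrite /P SH finset.subsetUr.
case: (@arg_minnP _ S P (fun S' => #|S' :\: W|) PS) => S1 /andP[S1H S1WS] minS1.
exists (S1 :\: W); last by rewrite finset.subDset.
rewrite inE; apply/andP; split; first by apply/exists_inP; exists S1.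
apply/forall_inP => S2 S2H; apply/implyP => sub; apply: minS1.
rewrite /P S2H; apply: (fintype.subset_trans sub).
rewrite finset.subUset finset.subsetUl.
by rewrite (fintype.subset_trans (finset.subsetDl _ _)).
Qed.

Lemma fragment_complete (U : finType) (H : {set {set U}}) (W T : {set U}) :
  T \in fragments H W -> exists2 S, S \in H & S \subset W :|: T.
Proof.
rewrite inE => /andP[/exists_inP[S SH /eqP ->] _]; exists S => //.
by rewrite -finset.subDset.
Qed.

(** [S :\: W] is contained in [T] and, by minimality, is no smaller, so the two are equal. *)
Lemma fragment_sub_edge (U : finType) (H : {set {set U}}) (W T S : {set U}) :
  T \in fragments H W -> S \in H -> S \subset W :|: T -> T \subset S.
Proof.
rewrite inE => /andP[_ /forall_inP min] SH SWT.
have := min S SH; rewrite SWT /= => le.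
have sub : S :\: W \subset T by rewrite finset.subDset.
have /eqP <- : S :\: W == T by rewrite eqEcard sub.
exact: finset.subsetDl.
Qed.

Lemma expect_cost_fragments (R : realType) (U : finType) (lam P : R) (k l : nat)
    (H : {set {set U}}) :
  0 <= lam <= 1 -> 0 <= P <= 1 -> (forall S, S \in H -> (#|S| <= l)%N) ->
  expect (fun=> P)
    (fun W => cost (lam * P) [set T in fragments H W | (k <= #|T|)%N])
  <= 2 ^+ l * lam ^+ k.
Proof.
move=> /andP[lam0 lam1] P01 Hl.
(* The edge is chosen from [Z] alone, so given [Z] there are at most [2 ^ l] candidates for [T].
   Whenever [Z = W :|: T] for a fragment [T], some edge lies in [Z] and the default is not taken. *)
pose sel (Z : {set U}) := odflt finset.set0 [pick S in H | S \subset Z].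
have sell Z : (#|sel Z| <= l)%N.
  rewrite /sel; case: pickP => /= [S /andP[/Hl //]|_]; by rewrite cards0.
apply: le_trans (le_expect_cost
  (h := fun Z T => (k <= #|T|)%N && (T \subset sel Z)) lam0 P01 _) _.
  move=> W T; rewrite inE => /andP[TF ->] /=.
  have [S SH SWT] := fragment_complete TF.
  rewrite /sel; case: pickP => [S' /andP[]|/(_ S)] /=; last by rewrite SH SWT.
  exact: fragment_sub_edge.
rewrite -[leRHS](@expect_cst R U (fun=> P) _); apply: le_expect => // Z.
apply: (@le_trans _ _ (\sum_(T in powerset (sel Z)) lam ^+ k)).
  rewrite [leLHS]big_mkcond [leRHS]big_mkcond; apply: ler_sum => T _.
  rewrite powersetE; case: (T \subset sel Z); rewrite ?andbF // ?andbT.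
  case: ifP => [/andP[_ kT]|_]; last exact: exprn_ge0.
  by rewrite ler_wiXn2l.
rewrite sumr_const card_powerset -[leLHS]mulr_natl natrX ler_wpM2r ?exprn_ge0 //.
by rewrite ler_weXn2l // ler1n.
Qed.

Lemma onem_expr_itv (R : realType) (P : R) n :
  0 <= P <= 1 -> 0 <= 1 - (1 - P) ^+ n <= 1.
Proof.
move=> /andP[P0 P1]; have Q0 : 0 <= 1 - P by rewrite subr_ge0.
by rewrite subr_ge0 exprn_ile1 ?lerBlDr ?lerDl ?exprn_ge0.
Qed.

(** The error is the geometric sum of [8^-1 ^+ i] for [i] from 1 to [k], one term per round. *)
Lemma miss_bounded (R : realType) (U : finType) (P : R) (k : nat)
    (H : {set {set U}}) (c : R) :
  0 <= P <= 1 -> (forall S, S \in H -> (#|S| < 2 ^ k)%N) ->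
  (forall G, covers G H -> c <= cost (32^-1 * P) G) ->
  miss (1 - (1 - P) ^+ k) H <= 1 - c + (1 - 8^-1 ^+ k) / 7.
Proof.
move=> P01; have /andP[P0 P1] := P01.
elim: k H c => [|k IH] H c Hk boundH.
  rewrite !expr0 subrr mul0r addr0.
  (* All edges are empty now. Either the empty edge is present, nothing is missed and its singleton
     is a cover of cost 1, or [H] is empty and the empty cover forces [c <= 0]. *)
  have [H0|H0] := boolP (finset.set0 \in H).
    apply: (@le_trans _ _ 0).
      rewrite /miss -[leRHS](@expect_cst R U (fun=> 0) _); apply: le_expect.
        by move=> _; rewrite lexx ler01.
      move=> W; suff -> : contains_member H W by [].
      by apply/exists_inP; exists finset.set0 => //; apply: finset.sub0set.
    have := boundH [set finset.set0]; rewrite /cost big_set1 cards0 expr0 subr_ge0.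
    by apply=> S _; exists finset.set0; rewrite ?inE ?finset.sub0set.
  suff c0 : c <= 0.
    apply: (@le_trans _ _ 1); last by rewrite lerBrDr gerDl.
    rewrite /miss -[leRHS](@expect_cst R U (fun=> 0) _); apply: le_expect.
      by move=> _; rewrite lexx ler01.
    by move=> W; rewrite lern1 leq_b1.
  have := boundH finset.set0; rewrite /cost finset.big_set0; apply=> S SH.
  have := Hk S SH; rewrite expn0 ltnS leqn0 cards_eq0 => /eqP S0.
  by rewrite -S0 SH in H0.
have -> : 1 - (1 - P) ^+ k.+1 = 1 - (1 - P) * (1 - (1 - (1 - P) ^+ k)).
  by rewrite exprS; ring.
apply: le_trans (miss_round
   (G := fun W => [set T in fragments H W | (2 ^ k <= #|T|)%N])
   (H' := fun W => [set T in fragments H W | (#|T| < 2 ^ k)%N])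
   (p := 32^-1 * P) (c := c) (eps := (1 - 8^-1 ^+ k) / 7)
   (delta := 8^-1 ^+ k.+1) _ P01 (onem_expr_itv k P01) _ _ _ _ boundH) _.
- by rewrite mulr_ge0 // invr_ge0.
- move=> W G' covG' S SH.
  have [T TF TS] := fragment_subset W SH.
  have [Tk|Tk] := leqP (2 ^ k) #|T|.
    by exists T => //; rewrite finset.in_setU finset.in_set TF Tk.
  have [|T' T'G' T'T] := covG' T; first by rewrite inE TF.
  by exists T'; rewrite ?inE ?T'G' ?orbT //; apply: fintype.subset_trans TS.
- move=> W W' /exists_inP[T]; rewrite inE => /andP[TF _] TW'.
  have [S SH SWT] := fragment_complete TF.
  apply/exists_inP; exists S => //; apply: fintype.subset_trans SWT _.
  exact: finset.setUS.
- move=> W c' boundH'; apply: IH => // S; by rewrite inE => /andP[].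
- apply: le_trans (expect_cost_fragments (l := 2 * 2 ^ k) _ _ P01 _) _.
  + by rewrite invr_ge0 invf_le1 ?ler1n ?ler0n ?ltr0n.
  + by move=> S SH; rewrite -expnS ltnW ?Hk.
  (* With at most [2 * 2 ^ k] points per edge the bound is [8^-1 ^+ (2 ^ k)], and
     [k.+1 <= 2 ^ k]. *)
  rewrite exprM -exprMn (_ : 2 ^+ 2 * 32^-1 = 8^-1 :> R); last by field.
  by rewrite ler_wiXn2l ?invr_ge0 ?invf_le1 ?ler1n ?ler0n ?ltr0n // ltn_expl.
rewrite lerD2l exprS; lra.
Qed.

(** * Attainment of the expectation threshold *)

(** There are finitely many families [G], and each contributes a closed sublevel set of a
    polynomial. *)
Lemma closed_small_cover_set (R : realType) (U : finType)
    (F : {set {set U}}) : closed (small_cover_set F : set R).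
Proof.
have -> : (small_cover_set F : set R) = (\bigcup_(G in [set G | covers G F])
    (`[0%R, 1%R] `&` (fun p : R => cost p G) @^-1` [set x | x <= 1 / 2]))%classic.
  apply/seteqP; split=> [p [p01 [G cG Gp]]|p [G cG [p01 Gp]]].
    by exists G => //; split => //=; rewrite in_itv.
  by split; [rewrite /= in_itv in p01 | exists G].
apply: closed_bigcup => [|G _]; first exact: finite_finset.
apply: closedI; first exact: itv_closed.
apply: preimage_closed; last exact: closed_le.
move=> x _; apply: cvg_big => [|T _]; first exact: add_continuous.
exact: exprn_continuous.
Qed.

Lemma expectation_threshold_max (R : realType) (U : finType)
    (F : {set {set U}}) :
  finset.set0 \notin F ->
  ((small_cover_set F : set R) `&` ubound (small_cover_set F))%classic
    (expectation_threshold R F).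
Proof.
move=> F0; rewrite /expectation_threshold; set A : set R := small_cover_set F.
apply: (@xgetPex _ 0 (A `&` ubound A)%classic).
have A0 : A 0.
  split; first by rewrite lexx ler01.
  exists F; first by move=> S SF; exists S.
  rewrite big1 ?divr_ge0 // => S SF; rewrite expr0n cards_eq0.
  by case: eqP => // S0; rewrite -S0 SF in F0.
have ubA : has_ubound A by exists 1 => p [/andP[]].
exists (sup A); split; last exact: ub_le_sup.
by apply: (@closed_small_cover_set R U F); apply: closure_sup => //; exists 0.
Qed.

(** * Dependence of the miss probability on the density *)

Lemma binPr_miss (R : realType) (U : finType) (P : R) (F : {set {set U}}) :
  binPr P (contains_member F) = 1 - miss P F.
Proof.
apply/eqP; rewrite eq_sym subr_eq eq_sym -[1](@expect_cst R U (fun=> P)).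
rewrite /binPr big_mkcond -big_split; apply/eqP; apply: eq_bigr => W _ /=.
rewrite -/(bernoulli_mass (fun=> P) W).
by case: (contains_member F W); rewrite ?(mulr0, mulr1, add0r, addr0).
Qed.

(** The union of two independent sets can miss [F] only if both do. *)
Lemma miss_le_mul (R : realType) (U : finType) (P Q : R) (F : {set {set U}}) :
  0 <= P <= 1 -> 0 <= Q <= 1 ->
  miss (1 - (1 - P) * (1 - Q)) F <= miss P F * miss Q F.
Proof.
move=> P01 Q01; rewrite {1}/miss -(expect_setU (fun=> P) (fun=> Q)).
rewrite mulrC -expectZ; apply: le_expect => // W.
rewrite mulrC -expectZ; apply: le_expect => // W'.
rewrite -natrM mulnb ler_nat -negb_or.
case: (boolP (_ || _)) => [/orP sub|_]; last exact: leq_b1.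
suff -> : contains_member F (W :|: W') by [].
case: sub => /exists_inP[S SF SW]; apply/exists_inP; exists S => //;
  apply: (fintype.subset_trans SW).
- exact: finset.subsetUl.
- exact: finset.subsetUr.
Qed.

Lemma miss_itv (R : realType) (U : finType) (P : R) (F : {set {set U}}) :
  0 <= P <= 1 -> 0 <= miss P F <= 1.
Proof.
move=> P01; rewrite -[X in _ <= _ <= X](@expect_cst R U (fun=> P)).
rewrite -[X in X <= _](@expect_cst R U (fun=> P)).
by apply/andP; split; apply: le_expect => // W; rewrite ?ler0n ?lern1 ?leq_b1.
Qed.

Lemma miss_nonincreasing (R : realType) (U : finType) (P P' : R)
    (F : {set {set U}}) :
  0 <= P -> P <= P' -> P' <= 1 -> miss P' F <= miss P F.
Proof.
move=> P0 PP' P'1; have [P1|P1] := eqVneq P 1.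
  by have -> : P' = P by apply/eqP; rewrite eq_le PP' P1 P'1.
have Plt : 0 < 1 - P by rewrite subr_gt0 lt_neqAle P1 (le_trans PP').
have P01 : 0 <= P <= 1 by rewrite P0 (le_trans PP').
(* [Q] is the density of the independent set whose addition raises [P] to [P']. *)
pose Q := (P' - P) / (1 - P).
have Q01 : 0 <= Q <= 1.
  apply/andP; split; first by rewrite divr_ge0 ?(ltW Plt) // subr_ge0.
  by rewrite ler_pdivrMr // mul1r lerB.
have -> : P' = 1 - (1 - P) * (1 - Q) by rewrite /Q; field; rewrite gt_eqF.
apply: (le_trans (miss_le_mul _ P01 Q01)).
by rewrite ler_piMr //; [case/andP: (miss_itv F P01)|case/andP: (miss_itv F Q01)].
Qed.

(** * The first round and the threshold bound *)

Lemma miss_small_intersections (R : realType) (U : finType) (P c : R) (s k : nat)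
    (F : {set {set U}}) :
  0 <= P <= 1 -> finset.set0 \notin F ->
  (forall A B : {set U}, A \in F -> B \in F -> A != B -> (#|A :&: B| <= s)%N) ->
  (s < 2 ^ k)%N ->
  (forall G, covers G F -> c <= cost (32^-1 * P) G) ->
  miss (1 - (1 - P) ^+ k.+1) F <= 1 - c + (1 / 7 + 1 / 32).
Proof.
move=> P01 F0 Fs sk boundF; have /andP[P0 P1] := P01.
have -> : 1 - (1 - P) ^+ k.+1 = 1 - (1 - P) * (1 - (1 - (1 - P) ^+ k)).
  by rewrite exprS; ring.
pose lonely (Z S : {set U}) := [forall S' in F, (S' \subset Z) ==> (S' == S)].
apply: (miss_round
   (G := fun W => [set S in F | lonely (W :|: S) S])
   (H' := fun W => [set T | [exists S in F, T == S :\: W] && (#|T| <= s)%N])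
   _ P01 (onem_expr_itv k P01) _ _ _ _ boundF).
- by rewrite mulr_ge0 // invr_ge0.
- move=> W G' covG' S SF.
  have [SW|/forall_inPn[S' S'F]] := boolP (lonely (W :|: S) S).
    by exists S; rewrite // finset.in_setU finset.in_set SF SW.
  rewrite negb_imply => /andP[S'W S'S].
  (* The leftover of [S'] lies in both [S] and [S'], hence has at most [s] points. *)
  have sub : S' :\: W \subset S by rewrite finset.subDset.
  have [|T TG' TS] := covG' (S' :\: W).
    rewrite finset.in_set; apply/andP; split; first by apply/exists_inP; exists S'.
    apply: leq_trans (Fs _ _ S'F SF S'S); apply: subset_leq_card.
    by rewrite finset.subsetI finset.subsetDl.
  by exists T; rewrite ?finset.in_setU ?TG' ?orbT // (fintype.subset_trans TS).
- move=> W W' /exists_inP[T]; rewrite finset.in_set.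
  move=> /andP[/exists_inP[S SF /eqP ->] _] TW'.
  by apply/exists_inP; exists S; rewrite // -finset.subDset.
- move=> W c' bound'.
  apply: (le_trans (miss_bounded (c := c') (k := k) P01 _ bound')).
    by move=> S; rewrite finset.in_set => /andP[_ /leq_ltn_trans]; apply.
  by rewrite lerD2l ler_pdivrMr // divfK // gerBl exprn_ge0 ?invr_ge0.
- apply: le_trans (le_expect_cost
    (h := fun Z S => (S \in F) && lonely Z S) _ P01 _) _.
  + by rewrite invr_ge0.
  + by move=> W S; rewrite finset.in_set.
  rewrite -[leRHS](@expect_cst R U (fun=> P)); apply: le_expect => // Z.
  (* At most one edge is lonely in a given [Z]; being nonempty, it contributes at most [32^-1]. *)
  apply: (@le_trans _ _
    (\sum_(T in [set T in F | (T \subset Z) && lonely Z T]) 32^-1)).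
    rewrite [leLHS]big_mkcond [leRHS]big_mkcond; apply: ler_sum => T _.
    rewrite finset.in_set andbCA; case: (boolP (T \in F)) => //= TF.
    case: ifP => // _; rewrite -[leRHS]expr1.
    rewrite ler_wiXn2l ?invr_ge0 ?invf_le1 ?ler1n ?ltr0n //.
    by rewrite card_gt0; apply: contraNneq F0 => <-.
  rewrite sumr_const -[leLHS]mulr_natl div1r ler_piMl ?invr_ge0 // lern1.
  apply/card_le1P => S; rewrite finset.in_set => /and3P[SF SZ loneS] S'.
  rewrite finset.in_set !inE; apply/idP/eqP => [/and3P[S'F S'Z _]|->].
    by have /forall_inP/(_ _ S'F) := loneS; rewrite S'Z => /eqP.
  by rewrite SF SZ.
Qed.

Lemma onem_expr_le (R : realType) (P : R) n :
  0 <= P <= 1 -> 1 - (1 - P) ^+ n <= n%:R * P.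
Proof.
move=> /andP[P0 P1]; elim: n => [|n IH]; first by rewrite expr0 subrr mul0r.
have : (1 - P) ^+ n <= 1 by rewrite exprn_ile1 ?subr_ge0 // lerBlDr lerDl.
rewrite exprS -natr1 mulrDl mul1r => le1.
have : P * (1 - P) ^+ n <= P * 1 by rewrite ler_wpM2l.
by lra.
Qed.

(** Two copies of [k.+1] rounds of density [32 * p] have total density at most [64 * k.+1 * p]. The
    bound is shown for every [p] above [q], where all covers cost more than 1/2, and then [p] tends
    to [q]. *)
Lemma threshold_le_rounds (R : realType) (U : finType) (s k : nat)
    (F : {set {set U}}) :
  finset.set0 \notin F ->
  (forall A B : {set U}, A \in F -> B \in F -> A != B -> (#|A :&: B| <= s)%N) ->
  (s < 2 ^ k)%N ->
  threshold R F <= 64 * k.+1%:R * expectation_threshold R F.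
Proof.
move=> F0 Fs sk; set q := expectation_threshold R F.
have [[/andP[q0 q1] _] qmax] := expectation_threshold_max R F0.
rewrite /threshold; case: xgetP => [t _ [/andP[t0 t1] tF]|_]; last first.
  by rewrite !mulr_ge0.
have le_rounds p : q < p -> t <= 64 * k.+1%:R * p.
  move=> qp; have p0 : 0 < p by apply: le_lt_trans qp.
  have [P1|P1] := leP (32 * p) 1; last first.
    apply: (le_trans t1); have : (1 : R) <= k.+1%:R by rewrite ler1n.
    by move: (k.+1%:R : R) => x x1; nra.
  have P0 : 0 <= 32 * p by rewrite mulr_ge0 ?(ltW p0).
  have P01 : 0 <= 32 * p <= 1 by rewrite P0.
  have hard G : covers G F -> 1 / 2 <= cost (32^-1 * (32 * p)) G.
    move=> cG; rewrite mulrA mulVf // [1 * p]mul1r leNgt; apply/negP => /ltW small.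
    suff : p <= q by rewrite leNgt qp.
    apply: qmax; split; first by rewrite (ltW p0); lra.
    by exists G.
  have miss1 := miss_small_intersections P01 F0 Fs sk hard.
  set P := 1 - (1 - 32 * p) ^+ k.+1 in miss1 *.
  have P'01 : 0 <= P <= 1 by exact: onem_expr_itv.
  have miss2 := miss_le_mul F P'01 P'01.
  have e : 1 - (1 - P) * (1 - P) = 1 - (1 - 32 * p) ^+ (k.+1 + k.+1).
    by rewrite exprD /P; ring.
  have le2 : 1 - (1 - P) * (1 - P) <= 64 * k.+1%:R * p.
    rewrite e; apply: le_trans (onem_expr_le _ P01) _.
    by rewrite natrD le_eqVlt; apply/orP; left; apply/eqP; ring.
  (* If [t] exceeded the density of both copies, the miss probability at [t] would be at most
     [(1/2 + 1/7 + 1/32)^2 < 1/2], whereas it equals 1/2. *)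
  apply: le_trans le2; rewrite leNgt; apply/negP => lt_t.
  have /andP[m0 _] := miss_itv F P'01.
  have := miss_nonincreasing F _ (ltW lt_t) t1.
  rewrite e; have /andP[-> _] := onem_expr_itv (k.+1 + k.+1) P01 => /(_ isT).
  rewrite -e; move: tF; rewrite binPr_miss => tF mt.
  by nra.
apply/ler_addgt0Pr => e e0.
pose K : R := 64 * k.+1%:R; have K0 : 0 < K by rewrite mulr_gt0.
have := le_rounds (q + e / K); rewrite -/K ltrDl divr_gt0 // => /(_ isT).
by rewrite mulrDr [K * (e / K)]mulrC divfK // gt_eqF.
Qed.

Theorem corollary1p5 (R : realType) :
  exists C : R, 0 < C /\
    forall (s : nat) (U : finType) (F : {set {set U}}),
      F != finset.set0 ->
      finset.set0 \notin F ->
      (forall A B : {set U}, A \in F -> B \in F -> A != B ->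
         (#|A :&: B| <= s)%N) ->
      threshold R F <= C * expectation_threshold R F * ln (s%:R + 2).
Proof.
have ln20 : 0 < ln (2 : R) by rewrite ln_gt0 // ltr1n.
(* 192 is 64 times 3: the [k.+2] rounds number at most three times the binary logarithm of [s + 2],
   because [2 ^ k <= s + 1] and that logarithm is at least 1. *)
exists (192 / ln 2); split; first by rewrite divr_gt0.
move=> s U F _ F0 Fs.
have /andP[lo hi] := trunc_log_bounds (isT : (1 < 2)%N) (ltn0Sn s).
set k := trunc_log 2 s.+1 in lo hi.
have := threshold_le_rounds R F0 Fs (ltnW hi : (s < 2 ^ k.+1)%N).
have [[/andP[q0 _] _] _] := expectation_threshold_max R F0.
move=> /le_trans; apply; rewrite [leRHS]mulrAC ler_wpM2r //.
have ln2s : ln 2 <= ln (s%:R + 2 : R).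
  by rewrite ler_ln ?posrE ?lerDr ?ler0n // ltr_wpDl.
have lnk : ln 2 * k%:R <= ln (s%:R + 2 : R).
  rewrite mulr_natr -lnXn // ler_ln ?posrE ?exprn_gt0 ?ltr_wpDl //.
  by rewrite -natrX -natrD ler_nat addn2 ltnW // ltnS.
rewrite mulrAC ler_pdivlMr // -[k.+2]addn2 natrD.
by lra.
Qed.
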